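(* Let $CC$ be a C-system and $n\ge 1$. Then the family of functions, parametrized by $\Gamma\in Ob(CC)$, $$S\widetilde{\mathcal{O}b}_{n,\Gamma}: Sig(\widetilde{\mathcal{O}b}_n)(\Gamma)\to \widetilde{\mathcal{O}b}_{n+1}(\Gamma),\qquad (T,o)\mapsto o,$$ is well defined and is an isomorphism of presheaves $S\widetilde{\mathcal{O}b}_n: Sig(\widetilde{\mathcal{O}b}_n)\to\widetilde{\mathcal{O}b}_{n+1}$ on $CC$.
   Context: Conventions. Composition is written in diagrammatic order: for $f:X\to Y$, $g:Y\to Z$ the composite is $f\circ g:X\to Z$. $\amalg_{i\in I}A_i$ denotes the set of pairs $(i,a)$ with $i\in I$, $a\in A_i$. For a morphism $p:Y\to X$, $sec(p)=\{s:X\to Y\mid s\circ p=Id_X\}$. C-systems. A C-system (contextual category) $CC$ is a category with: a length function $l:Ob(CC)\to\mathbb N$; an object $pt$; a function $ft:Ob(CC)\to Ob(CC)$; for each object $X$ a morphism $p_X:X\to ft(X)$; and for each $X$ with $l(X)>0$ and each $f:Y\to ft(X)$ an object $f^*(X)$ and a morphism $q(f,X):f^*(X)\to X$; such that: $l^{-1}(0)=\{pt\}$; $l(ft(X))=l(X)-1$ if $l(X)>0$; $ft(pt)=pt$; $pt$ is final; for $l(X)>0$ and $f:Y\to ft(X)$ one has $l(f^*(X))>0$, $ft(f^*(X))=Y$, $p_{f^*(X)}\circ f=q(f,X)\circ p_X$ and this square is a pullback; $Id_{ft(X)}^*(X)=X$, $q(Id_{ft(X)},X)=Id_X$; and for $g:Z\to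 Y$, $f:Y\to ft(X)$, $(g\circ f)^*(X)=g^*(f^*(X))$ and $q(g\circ f,X)=q(g,f^*(X))\circ q(f,X)$. The presheaves. For $\Gamma\in CC$, $\mathcal{O}b_n(\Gamma)=\{T\in Ob(CC)\mid l(T)=l(\Gamma)+n,\ ft^n(T)=\Gamma\}$. For $f:\Gamma'\to\Gamma$ and $T\in\mathcal{O}b_n(\Gamma)$ define recursively in $n$: for $n=0$, $f^*(T)=\Gamma'$ and $q(f,T)=f$; for $n\geq 1$, $f^*(T)=q(f,ft(T))^*(T)$ and $q(f,T)=q(q(f,ft(T)),T):f^*(T)\to T$. Then $\mathcal{O}b_n$ is a presheaf with $\mathcal{O}b_n(f)(T)=f^*(T)$. For $n\ge 1$, $\widetilde{\mathcal{O}b}_n(\Gamma)$ is the set of morphisms $o$ of $CC$ such that $\partial(o):=codom(o)\in\mathcal{O}b_n(\Gamma)$ and $o\in sec(p_{\partial(o)})$. For $f:\Gamma'\to\Gamma$ and $o\in\widetilde{\mathcal{O}b}_n(\Gamma)$, $f^*(o)$ is the unique element of $sec(p_{f^*(\partial(o))})$ with $f^*(o)\circ q(f,\partial(o))=q(f,ft(\partial(o)))\circ o$; this makes $\widetilde{\mathcal{O}b}_n$ a presheaf with $\widetilde{\mathcal{O}b}_n(f)(o)=f^*(o)$. The functor $Sig$. For a presheaf $\mathcal G$ on $CC$, $Sig(\mathcal G)$ is the presheaf with $Sig(\mathcal G)(\Gamma)=\amalg_{T\in\mathcal{O}b_1(\Gamma)}\mathcal G(T)$ and, for $f:\Gamma'\to\Gamma$,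 $Sig(\mathcal G)(f)(T,g)=(f^*(T),\mathcal G(q(f,T))(g))$. On a morphism $r:\mathcal G\to\mathcal G'$, $Sig(r)_\Gamma(T,g)=(T,r_T(g))$. *)

(* Defs.v *)
From mathcomp Require Import all_boot.
From mathcomp Require Import boolp.

Set Implicit Arguments.
Unset Strict Implicit.
Unset Printing Implicit Defensive.

(* Composition is diagrammatic: [f ;; g] is "first f, then g". *)
Record category := Category {
  ob :> Type;
  hom : ob -> ob -> Type;
  idm : forall X, hom X X;
  comp : forall X Y Z, hom X Y -> hom Y Z -> hom X Z;
  comp1m : forall X Y (f : hom X Y), comp (idm X) f = f;
  compm1 : forall X Y (f : hom X Y), comp f (idm Y) = f;
  compA : forall X Y Z W (f : hom X Y) (g : hom Y Z) (h : hom Z W),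
    comp f (comp g h) = comp (comp f g) h }.

Arguments hom {c} X Y : rename.
Arguments idm {c} X : rename.
Arguments comp {c X Y Z} f g : rename.
Notation "f ;; g" := (comp f g) (at level 50, left associativity).

Definition is_final (C : category) (X : C) : Prop :=
  forall Y : C, exists! f : hom Y X, True.

(* The square   P --b--> X
                |        |
                a        d
                v        v
                Y --c--> Z   is commutative and cartesian. *)
Definition is_pullback (C : category) (P X Y Z : C)
    (a : hom P Y) (b : hom P X) (c : hom Y Z) (d : hom X Z) : Prop :=
  a ;; c = b ;; d /\
  forall (W : C) (u : hom W Y) (v : hom W X), u ;; c = v ;; d ->
    exists! w : hom W P, w ;; a = u /\ w ;; b = v.

(* Transport of a morphism along an equality of codomains. *)
Definition cast_cod (C : category) (X Y Y' : C) (e : Y = Y') (f : hom X Y) :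
    hom X Y' :=
  ecast Z (hom X Z) e f.

(* A morphism of codomain T together with its domain.  Equality in this type is
   equality of morphisms (hence of their domains) in the set of all morphisms. *)
Definition hom_to (C : category) (T : C) := {X : C & hom X T}.
Definition Hom_to (C : category) (X T : C) (f : hom X T) : hom_to T :=
  existT (fun X => hom X T) X f.

Lemma Hom_to_inj (C : category) (X T : C) (f g : hom X T) :
  Hom_to f = Hom_to g -> f = g.
Proof.
move=> E; have := projT2_eq E.
by rewrite (Prop_irrelevance (projT1_eq E) erefl).
Qed.

(* [pr X] is p_X : X -> ft X; for f : Y -> ft X, [pb h f] is f^*(X) and
   [q h f] is q(f, X) : f^*(X) -> X, where h is the (irrelevant) proof of
   l(X) > 0.  The equations on q are equations in [hom_to X], so that they
   comprise the equations between objects Id^*(X) = X and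
   (g ;; f)^*(X) = g^*(f^*(X)). *)
Record Csystem := CSystem {
  base :> category;
  len : base -> nat;
  pt : base;
  ft : base -> base;
  pr : forall X : base, hom X (ft X);
  pb : forall X Y : base, 0 < len X -> hom Y (ft X) -> base;
  q : forall (X Y : base) (h : 0 < len X) (f : hom Y (ft X)), hom (pb h f) X;
  len_eq0 : forall X, len X = 0 <-> X = pt;
  len_ft : forall X, 0 < len X -> len (ft X) = len X - 1;
  ft_pt : ft pt = pt;
  pt_final : is_final pt;
  len_pb : forall X Y (h : 0 < len X) (f : hom Y (ft X)), 0 < len (pb h f);
  ft_pb : forall X Y (h : 0 < len X) (f : hom Y (ft X)), ft (pb h f) = Y;
  pb_square : forall X Y (h : 0 < len X) (f : hom Y (ft X)),
    is_pullback (cast_cod (ft_pb h f) (pr (pb h f))) (q h f) f (pr X);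
  q_id : forall X (h : 0 < len X), Hom_to (q h (idm (ft X))) = Hom_to (idm X);
  q_comp : forall X Y Z (h : 0 < len X) (f : hom Y (ft X)) (g : hom Z Y),
    Hom_to (q h (g ;; f)) =
    Hom_to (q (len_pb h f) (cast_cod (esym (ft_pb h f)) g) ;; q h f) }.

Arguments len {c} X : rename.
Arguments ft {c} X : rename.
Arguments pr {c} X : rename.
Arguments pb {c X Y} h f : rename.
Arguments q {c X Y} h f : rename.

Record presheaf (C : category) := Presheaf {
  psh_ob :> C -> Type;
  psh_map : forall X Y : C, hom X Y -> psh_ob Y -> psh_ob X;
  psh_id : forall (X : C) (x : psh_ob X), psh_map (idm X) x = x;
  psh_comp : forall (X Y Z : C) (g : hom X Y) (f : hom Y Z) (x : psh_ob Z),
    psh_map (g ;; f) x = psh_map g (psh_map f x) }.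

Arguments psh_map {C} p {X Y} f x : rename.

Record psh_hom (C : category) (F G : presheaf C) := PshHom {
  psh_fun :> forall X : C, F X -> G X;
  psh_nat : forall (X Y : C) (f : hom X Y) (y : F Y),
    psh_fun (psh_map F f y) = psh_map G f (psh_fun y) }.

Definition psh_iso (C : category) (F G : presheaf C) (r : psh_hom F G) : Prop :=
  exists r' : psh_hom G F,
    (forall (X : C) (x : F X), r' X (r X x) = x) /\
    (forall (X : C) (y : G X), r X (r' X y) = y).

(* T belongs to Ob_n(Gam). *)
Definition in_Ob (CC : Csystem) (n : nat) (Gam T : CC) : Prop :=
  len T = len Gam + n /\ iter n ft T = Gam.

Lemma in_Ob0 (CC : Csystem) (Gam T : CC) : in_Ob 0 Gam T -> Gam = T.
Proof. by case. Qed.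

Lemma in_Ob_gt0 (CC : Csystem) (n : nat) (Gam T : CC) :
  0 < n -> in_Ob n Gam T -> 0 < len T.
Proof. by case: n => // n _ [-> _]; rewrite addnS. Qed.

Lemma in_Ob_ft (CC : Csystem) (n : nat) (Gam T : CC) :
  0 < n -> in_Ob n Gam T -> in_Ob n.-1 Gam (ft T).
Proof.
move=> n0 hT; have lT := in_Ob_gt0 n0 hT; case: n n0 hT => // n _ [hl hi].
by split; [rewrite len_ft// hl addnS subn1 | rewrite -iterSr].
Qed.

(* For f : Gam' -> Gam and T in Ob_n(Gam), the morphism q(f, T) together with
   its domain f^*(T). *)
Fixpoint pull (CC : Csystem) (Gam Gam' : CC) (f : hom Gam' Gam) (n : nat) :
    forall T : CC, in_Ob n Gam T -> hom_to T :=
  match n with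
  | 0 => fun T hT => Hom_to (cast_cod (in_Ob0 hT) f)
  | m.+1 => fun T hT =>
      Hom_to (q (in_Ob_gt0 (ltn0Sn m) hT)
                (tagged (pull f (in_Ob_ft (ltn0Sn m) hT))))
  end.

Definition pull_ob (CC : Csystem) (Gam Gam' : CC) (f : hom Gam' Gam) (n : nat)
  (T : CC) (hT : in_Ob n Gam T) : CC := tag (pull f hT).
Definition pull_q (CC : Csystem) (Gam Gam' : CC) (f : hom Gam' Gam) (n : nat)
  (T : CC) (hT : in_Ob n Gam T) : hom (pull_ob f hT) T := tagged (pull f hT).

Lemma len_pbE (CC : Csystem) (X Y : CC) (h : 0 < len X) (f : hom Y (ft X)) :
  len (pb h f) = (len Y).+1.
Proof.
have h1 := len_pb h f.
by rewrite -{2}(ft_pb h f) len_ft// subn1 prednK.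
Qed.

Lemma pull_in_Ob (CC : Csystem) (Gam Gam' : CC) (f : hom Gam' Gam) (n : nat)
  (T : CC) (hT : in_Ob n Gam T) : in_Ob n Gam' (pull_ob f hT).
Proof.
elim: n T hT => [|n IH] T hT; first by split; rewrite //= addn0.
have [hl hi] := IH _ (in_Ob_ft (ltn0Sn n) hT).
by split; rewrite /pull_ob/= ?len_pbE ?hl ?addnS// -iterS iterSr ft_pb.
Qed.

Lemma pull_id (CC : Csystem) (Gam : CC) (n : nat) (T : CC)
  (hT : in_Ob n Gam T) : pull (idm Gam) hT = Hom_to (idm T).
Proof.
elim: n T hT => [|n IH] T hT /=; first by case: _ / (in_Ob0 hT).
by rewrite IH q_id.
Qed.

Lemma pull_eq (CC : Csystem) (Gam Gam' : CC) (f : hom Gam' Gam) (n : nat)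
    (T1 T2 : CC) (e : T1 = T2) (h1 : in_Ob n Gam T1) (h2 : in_Ob n Gam T2) :
  pull f h1 = Hom_to (cast_cod (esym e) (pull_q f h2)).
Proof.
case: _ / e h2 => h2; rewrite (Prop_irrelevance h2 h1) /pull_q /pull_ob /=.
by case: (pull f h1).
Qed.

Lemma pull_comp (CC : Csystem) (Gam Gam' Gam'' : CC) (g : hom Gam'' Gam')
    (f : hom Gam' Gam) (n : nat) (T : CC) (hT : in_Ob n Gam T)
    (hT' : in_Ob n Gam' (pull_ob f hT)) :
  pull (g ;; f) hT = Hom_to (pull_q g hT' ;; pull_q f hT).
Proof.
elim: n T hT hT' => [|n IH] T hT hT' /=.
  rewrite /pull_q /=; move: hT'; rewrite /pull_ob/= => hT'.
  rewrite (Prop_irrelevance (in_Ob0 hT') erefl) /=.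
  by case: _ / (in_Ob0 hT).
have h1 := pull_in_Ob f (in_Ob_ft (ltn0Sn n) hT).
rewrite (IH _ _ h1) /= q_comp.
set k := q _ (tagged (pull f _)).
suff E : pull g hT' = Hom_to (q (len_pb (in_Ob_gt0 (ltn0Sn n) hT) _)
    (cast_cod (esym (ft_pb _ _)) (tagged (pull g h1)))).
  by rewrite (congr1 (fun r : hom_to _ => Hom_to (tagged r ;; k)) E).
rewrite /= (pull_eq g (ft_pb _ _) (in_Ob_ft _ _) h1) /=.
by rewrite (bool_irrelevance (in_Ob_gt0 _ hT') (len_pb _ _)).
Qed.

Lemma pull_q_precomp (CC : Csystem) (Gam Gam' : CC) (f : hom Gam' Gam)
    (n : nat) (A B T : CC) (hA : in_Ob n Gam A) (hB : in_Ob n Gam B)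
    (u : hom A T) (v : hom B T) :
  Hom_to u = Hom_to v ->
  Hom_to (pull_q f hA ;; u) = Hom_to (pull_q f hB ;; v).
Proof.
move=> E; have e : A = B := projT1_eq E.
subst B; rewrite (Hom_to_inj E).
by rewrite (Prop_irrelevance hA hB).
Qed.

Definition Ob_map (CC : Csystem) (n : nat) (Gam' Gam : CC) (f : hom Gam' Gam)
    (T : {T : CC | in_Ob n Gam T}) : {T : CC | in_Ob n Gam' T} :=
  exist _ (pull_ob f (svalP T)) (pull_in_Ob f (svalP T)).

Lemma Ob_map_id (CC : Csystem) (n : nat) (Gam : CC)
  (T : {T : CC | in_Ob n Gam T}) : Ob_map (idm Gam) T = T.
Proof.
apply: eq_sig_hprop => [?|]; first exact: Prop_irrelevance.
exact: (projT1_eq (pull_id (svalP T))).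
Qed.

Lemma Ob_map_comp (CC : Csystem) (n : nat) (Gam'' Gam' Gam : CC)
    (g : hom Gam'' Gam') (f : hom Gam' Gam) (T : {T : CC | in_Ob n Gam T}) :
  Ob_map (g ;; f) T = Ob_map g (Ob_map f T).
Proof.
apply: eq_sig_hprop => [?|]; first exact: Prop_irrelevance.
exact: (projT1_eq (pull_comp g (svalP (Ob_map f T)))).
Qed.

Definition Ob (CC : Csystem) (n : nat) : presheaf CC :=
  Presheaf (@Ob_map_id CC n) (@Ob_map_comp CC n).

Definition sec (C : category) (X Y : C) (p : hom Y X) :=
  {s : hom X Y | s ;; p = idm X}.

(* A morphism o of CC with o in sec(p_T), T = codomain o, is a pair of T and a
   section of p_T; equality of such pairs is equality of morphisms of CC. *)
Definition section (CC : Csystem) := {T : CC & sec (pr T)}.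

Definition codomain (CC : Csystem) (o : section CC) : CC := tag o.
Definition arrow (CC : Csystem) (o : section CC) :
  hom (ft (codomain o)) (codomain o) := sval (tagged o).

(* The carrier of the presheaf \tilde{Ob}_n; it is only used for n >= 1. *)
Definition Obt_set (CC : Csystem) (n : nat) (Gam : CC) :=
  {o : section CC | in_Ob n Gam (codomain o)}.

(* For o in \tilde{Ob}_n(Gam), s is the section f^*(o):
   s ;; q(f, codomain o) = q(f, ft (codomain o)) ;; o.  The domains ft(f^*(codomain o))
   and f^*(ft (codomain o)) of both sides are equal, but not convertible. *)
Definition is_pull_sec (CC : Csystem) (n : nat) (hn : 0 < n) (Gam' Gam : CC)
    (f : hom Gam' Gam) (o : Obt_set n Gam)
    (s : sec (pr (pull_ob f (svalP o)))) : Prop :=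
  Hom_to (sval s ;; pull_q f (svalP o)) =
  Hom_to (pull_q f (in_Ob_ft hn (svalP o)) ;; arrow (sval o)).

Arguments is_pull_sec {CC n} hn {Gam' Gam} f o s.

Lemma sec_pullback (C : category) (P X Y Z W : C) (e : W = Y) (pP : hom P W)
    (b : hom P X) (c : hom Y Z) (d : hom X Z) (s : sec d) :
  is_pullback (cast_cod e pP) b c d ->
  exists! t : sec pP, Hom_to (sval t ;; b) = Hom_to (c ;; sval s).
Proof.
case: _ / e c => c /= [_ H].
have [|t [[t1 t2] tU]] := H _ (idm W) (c ;; sval s).
  by rewrite -compA (svalP s) compm1 comp1m.
exists (exist _ t t1); split; first by rewrite /= t2.
move=> [t' t'1] /= E; apply: eq_sig_hprop => [?|/=]; first exact: Prop_irrelevance.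
by apply: tU; split => //; apply: Hom_to_inj E.
Qed.

Lemma is_pull_sec_uniq (CC : Csystem) (n : nat) (hn : 0 < n) (Gam' Gam : CC)
    (f : hom Gam' Gam) (o : Obt_set n Gam) :
  exists! s, is_pull_sec hn f o s.
Proof.
rewrite /is_pull_sec /arrow; move: (svalP o).
case: (sval o) => T s; rewrite /codomain /= => hT.
case: n hn o hT => // n hn _ hT; rewrite /pull_ob /pull_q /=.
rewrite (bool_irrelevance hn (ltn0Sn n)).
exact: (sec_pullback s (pb_square _ _)).
Qed.

Definition Obt_map (CC : Csystem) (n : nat) (hn : 0 < n) (Gam' Gam : CC)
    (f : hom Gam' Gam) (o : Obt_set n Gam) : Obt_set n Gam' :=
  exist (fun o : section CC => in_Ob n Gam' (codomain o))
    (existT _ (pull_ob f (svalP o)) (sval (cid (is_pull_sec_uniq hn f o))))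
    (pull_in_Ob f (svalP o)).

Lemma Obt_mapE (CC : Csystem) (n : nat) (hn : 0 < n) (Gam' Gam : CC)
    (f : hom Gam' Gam) (o : Obt_set n Gam) (o' : Obt_set n Gam')
    (k : hom (codomain (sval o')) (codomain (sval o))) :
  pull f (svalP o) = Hom_to k ->
  Hom_to (arrow (sval o') ;; k) =
    Hom_to (pull_q f (in_Ob_ft hn (svalP o)) ;; arrow (sval o)) ->
  Obt_map hn f o = o'.
Proof.
move=> E Ek; apply: eq_sig_hprop => [?|]; first exact: Prop_irrelevance.
rewrite /Obt_map /=; case: cid => s [hs sU] /=.
case: o' k E Ek => -[T' s'] hT' /= k E Ek.
rewrite /is_pull_sec /pull_q in hs sU Ek; move: s hs sU; rewrite /pull_ob.
rewrite /codomain /= in k E Ek *; rewrite E /= => s hs sU.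
by rewrite (sU s').
Qed.

Lemma Obt_map_id (CC : Csystem) (n : nat) (hn : 0 < n) (Gam : CC)
  (o : Obt_set n Gam) : Obt_map hn (idm Gam) o = o.
Proof.
apply: (Obt_mapE (k := idm _)); first exact: pull_id.
by rewrite /pull_q /pull_ob pull_id /= compm1 comp1m.
Qed.

Lemma Obt_map_comp (CC : Csystem) (n : nat) (hn : 0 < n) (Gam'' Gam' Gam : CC)
    (g : hom Gam'' Gam') (f : hom Gam' Gam) (o : Obt_set n Gam) :
  Obt_map hn (g ;; f) o = Obt_map hn g (Obt_map hn f o).
Proof.
set o1 := Obt_map hn f o; set o2 := Obt_map hn g o1.
have E1 : is_pull_sec hn f o (tagged (sval o1)).
  by rewrite /o1 /=; case: cid => s [].
have E2 : is_pull_sec hn g o1 (tagged (sval o2)).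
  by rewrite /o2 /=; case: cid => s [].
pose k : hom (codomain (sval o2)) (codomain (sval o)) :=
  pull_q g (svalP o1) ;; pull_q f (svalP o).
apply: (Obt_mapE (k := k)); first exact: pull_comp.
rewrite /k compA (congr1 (fun r : hom_to _ => Hom_to (tagged r ;; _)) E2) /=.
have h1 := pull_in_Ob f (in_Ob_ft hn (svalP o)).
rewrite -compA (pull_q_precomp g _ h1 E1) compA.
by rewrite /pull_q /pull_ob (pull_comp g h1).
Qed.

Definition Obt (CC : Csystem) (n : nat) (hn : 0 < n) : presheaf CC :=
  Presheaf (@Obt_map_id CC n hn) (@Obt_map_comp CC n hn).
Arguments Obt CC {n} hn.

Definition Sig_map (CC : Csystem) (F : presheaf CC) (Gam' Gam : CC)
    (f : hom Gam' Gam) (x : {T : Ob CC 1 Gam & F (sval T)}) :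
    {T : Ob CC 1 Gam' & F (sval T)} :=
  existT (fun T : Ob CC 1 Gam' => F (sval T))
    (psh_map (Ob CC 1) f (tag x))
    (psh_map F (pull_q f (svalP (tag x))) (tagged x)).

Lemma Sig_mapE (CC : Csystem) (F : presheaf CC) (Gam' Gam : CC)
    (f : hom Gam' Gam) (x : {T : Ob CC 1 Gam & F (sval T)})
    (y : {T : Ob CC 1 Gam' & F (sval T)})
    (k : hom (sval (tag y)) (sval (tag x))) :
  pull f (svalP (tag x)) = Hom_to k ->
  tagged y = psh_map F k (tagged x) -> Sig_map f x = y.
Proof.
case: y k => [[T' hT'] b] k.
rewrite /Sig_map [psh_map (Ob CC 1)]/= /Ob_map.
move: (pull_in_Ob f _); rewrite /pull_q /pull_ob.
move: (pull f _) => r h E; move: h; rewrite E => h /= ->.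
by rewrite (Prop_irrelevance hT' h).
Qed.

Lemma Sig_map_id (CC : Csystem) (F : presheaf CC) (Gam : CC)
  (x : {T : Ob CC 1 Gam & F (sval T)}) : Sig_map (idm Gam) x = x.
Proof.
by apply: (Sig_mapE (k := idm _)); [exact: pull_id | rewrite psh_id].
Qed.

Lemma Sig_map_comp (CC : Csystem) (F : presheaf CC) (Gam'' Gam' Gam : CC)
    (g : hom Gam'' Gam') (f : hom Gam' Gam)
    (x : {T : Ob CC 1 Gam & F (sval T)}) :
  Sig_map (g ;; f) x = Sig_map g (Sig_map f x).
Proof.
set x1 := Sig_map f x; set x2 := Sig_map g x1.
pose k : hom (sval (tag x2)) (sval (tag x)) :=
  pull_q g (svalP (tag x1)) ;; pull_q f (svalP (tag x)).
apply: (Sig_mapE (k := k)); first exact: pull_comp.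
by rewrite psh_comp.
Qed.

Definition Sig (CC : Csystem) (F : presheaf CC) : presheaf CC :=
  Presheaf (@Sig_map_id CC F) (@Sig_map_comp CC F).

(* Main.v *)
Require Import Defs.
From mathcomp Require Import all_boot.
From mathcomp Require Import boolp.

(** Over a fixed [Gam], a tower of height [n.+1] is the same thing as a tower of
    height one, [T -> Gam], followed by a tower of height [n] over [T]
    ([in_Ob_trans], [in_Ob_iter]).  The middle object is [ft^n] of the top, so it
    is determined by the top, and forgetting it is a bijection from
    [Sig(Obt_n)(Gam)] to [Obt_(n+1)(Gam)]: the section itself is left untouched.

    Naturality is where the C-system is used.  Restricting [(T, o)] along [f]
    in [Sig] pulls [o] back along [q(f, T)], while restricting [o] in
    [Obt_(n+1)] pulls it back along [f].  These agree because [q(-, -)] is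
    defined one floor at a time, so that [q(q(f, T), X) = q(f, X)]
    ([pull_pull_q]); the two sections then satisfy the same equation, which has
    a unique solution ([SObt_nat]).  Finally, a pointwise bijective morphism of presheaves
    is an isomorphism ([psh_iso_cancel]). *)

Set Implicit Arguments.
Unset Strict Implicit.
Unset Printing Implicit Defensive.

(** Naturality of the inverse family is automatic. *)
Lemma psh_iso_cancel (C : category) (F G : presheaf C) (r : psh_hom F G)
    (s : forall X : C, G X -> F X) :
  (forall X, cancel (r X) (s X)) -> (forall X, cancel (s X) (r X)) ->
  psh_iso r.
Proof.
move=> rK sK.
have s_nat (X Y : C) (f : hom X Y) (y : G Y) :
    s X (psh_map G f y) = psh_map F f (s Y y).
  by rewrite -{1}(sK Y y) -psh_nat rK.
by exists (PshHom s_nat).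
Qed.

Section Towers.
Variable CC : Csystem.
Implicit Types (Gam T X : CC) (m n : nat).

Lemma in_Ob_trans m n Gam T X :
  in_Ob m Gam T -> in_Ob n T X -> in_Ob (n + m) Gam X.
Proof.
move=> [lT iT] [lX iX]; split; first by rewrite lX lT -addnA (addnC m).
by rewrite addnC iterD iX.
Qed.

Lemma len_iter_ft n X : len (iter n ft X) = len X - n.
Proof.
elim: n => [|n IH]; first by rewrite subn0.
rewrite iterS subnS -IH.
case: (posnP (len (iter n ft X))) => [l0|/len_ft->]; last by rewrite subn1.
(* below length one, ft is constant at pt *)
by rewrite l0 (proj1 (len_eq0 _) l0) ft_pt; apply/len_eq0.
Qed.

Lemma in_Ob_iter m n Gam X :
  in_Ob (n + m) Gam X ->
  in_Ob m Gam (iter n ft X) /\ in_Ob n (iter n ft X) X.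
Proof.
move=> [lX iX]; have lT := len_iter_ft n X.
split; split=> //; first by rewrite lT lX addnCA addKn.
  by rewrite -iterD addnC.
by rewrite lT subnK// lX addnCA leq_addr.
Qed.

(** Both sides are built by the same iteration of [q] over the floors between
    [T] and [X], started from [q(f, T)]. *)
Lemma pull_pull_q m n Gam Gam' (f : hom Gam' Gam) T X
    (hT : in_Ob m Gam T) (hX : in_Ob n T X) (hX' : in_Ob (n + m) Gam X) :
  pull (pull_q f hT) hX = pull f hX'.
Proof.
elim: n X hX hX' => [|n IH] X hX hX' /=.
  case: _ / (in_Ob0 hX) hX' => hX'.
  rewrite (Prop_irrelevance hX' hT) /pull_q /pull_ob /=.
  by case: (pull f hT).
rewrite (IH _ _ (in_Ob_ft (ltn0Sn (n + m)) hX')).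
by rewrite (bool_irrelevance (in_Ob_gt0 _ hX) (in_Ob_gt0 (ltn0Sn (n + m)) hX')).
Qed.

End Towers.

Section SigObt.
Variables (CC : Csystem) (n : nat) (hn : 0 < n).

Lemma Sig_Obt_in_Ob (Gam : CC) (T : Ob CC 1 Gam) (o : Obt CC hn (sval T)) :
  in_Ob n.+1 Gam (codomain (sval o)).
Proof. by rewrite -addn1; exact: in_Ob_trans (svalP T) (svalP o). Qed.

Definition SObt_fun (Gam : CC) (x : Sig (Obt CC hn) Gam) :
    Obt CC (ltn0Sn n) Gam :=
  exist (fun o : section CC => in_Ob n.+1 Gam (codomain o))
    (sval (tagged x)) (Sig_Obt_in_Ob (tagged x)).

Lemma Obt_map_spec (Gam' Gam : CC) (f : hom Gam' Gam) (o : Obt_set n Gam) :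
  is_pull_sec hn f o (tagged (sval (Obt_map hn f o))).
Proof. by rewrite /Obt_map /=; case: cid => s []. Qed.

(** By [pull_pull_q], the equation characterizing the pullback of [o] along
    [q(f, T)] is the one characterizing its pullback along [f]. *)
Lemma SObt_nat (Gam' Gam : CC) (f : hom Gam' Gam) (x : Sig (Obt CC hn) Gam) :
  SObt_fun (psh_map (Sig (Obt CC hn)) f x) =
  psh_map (Obt CC (ltn0Sn n)) f (SObt_fun x).
Proof.
pose T := tag x; pose o : Obt CC hn (sval T) := tagged x.
pose g := pull_q f (svalP T).
(* The height is a variable k', since both n.+1 and n = n.-1 + 1 occur below. *)
have eq_pull k k' X (hX : in_Ob k (sval T) X) (hX' : in_Ob k' Gam X) :
    k' = k + 1 -> pull f hX' = pull g hX.
  by move=> e; subst k'; rewrite (pull_pull_q f (svalP T) hX hX').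
(* The candidate for f^*(o) is g^*(o), with k = q(g, codomain o). *)
apply/esym/(@Obt_mapE _ _ _ _ _ f (SObt_fun x)
  (@SObt_fun Gam' (Sig_map f x)) (pull_q g (svalP o))).
  have E := eq_pull _ _ _ (svalP o) (svalP (SObt_fun x)) (esym (addn1 n)).
  exact: etrans E (pull_eq g erefl _ (svalP o)).
apply: etrans (Obt_map_spec g o) _.
have En : n = n.-1 + 1 by rewrite addn1 prednK.
have E := eq_pull _ _ _ (in_Ob_ft hn (svalP o))
  (in_Ob_ft (ltn0Sn n) (svalP (SObt_fun x))) En.
exact: (congr1 (fun r : hom_to _ => Hom_to (tagged r ;; arrow (sval o)))
  (esym E)).
Qed.

Definition SObt : psh_hom (Sig (Obt CC hn)) (Obt CC (ltn0Sn n)) :=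
  PshHom SObt_nat.

Definition SObt_inv (Gam : CC) (o : Obt CC (ltn0Sn n) Gam) :
    Sig (Obt CC hn) Gam :=
  let h := in_Ob_iter (eq_ind_r (fun k => in_Ob k Gam _) (svalP o) (addn1 n)) in
  existT (fun T : Ob CC 1 Gam => Obt CC hn (sval T))
    (exist _ _ (proj1 h)) (exist _ (sval o) (proj2 h)).

Lemma SObt_invK (Gam : CC) : cancel (@SObt_inv Gam) (SObt Gam).
Proof. by move=> o; apply: eq_sig_hprop => // ?; exact: Prop_irrelevance. Qed.

(** The middle object of a tower is recovered from its top by [ft^n]. *)
Lemma SObt_inj (Gam : CC) : injective (SObt Gam).
Proof.
move=> [[T hT] [o ho]] [[T' hT'] [o' ho']] /(congr1 sval) /= E; subst o'.
have eT : T = T' := etrans (esym (proj2 ho)) (proj2 ho').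
subst T'.
by rewrite (Prop_irrelevance hT' hT) (Prop_irrelevance ho' ho).
Qed.

Lemma SObtK (Gam : CC) : cancel (SObt Gam) (@SObt_inv Gam).
Proof. exact: inj_can_sym (@SObt_invK Gam) (@SObt_inj Gam). Qed.

End SigObt.

Theorem mainTheorem2 (CC : Csystem) (n : nat) (hn : 1 <= n) :
  (forall (Gam : CC) (T : Ob CC 1 Gam) (o : Obt CC hn (sval T)),
     in_Ob n.+1 Gam (codomain (sval o))) /\
  exists S : psh_hom (Sig (Obt CC hn)) (Obt CC (ltn0Sn n)),
    (forall (Gam : CC) (T : Ob CC 1 Gam) (o : Obt CC hn (sval T)),
       sval (S Gam (existT _ T o)) = sval o) /\
    psh_iso S.
Proof.
split; first exact: Sig_Obt_in_Ob.
exists (SObt CC hn); split=> //.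
exact: psh_iso_cancel (@SObtK CC n hn) (@SObt_invK CC n hn).
Qed.
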